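(* Let $\omega=\{\gamma_{ij}\}_{0\le i+j\le 6}$ be complex numbers with $\overline{\gamma_{ij}}=\gamma_{ji}$ and $\gamma_{00}>0$, and let $M(\omega)(3)$ be the associated moment matrix. Assume that $M(\omega)(3)\ge0$ and that its columns satisfy $Z^3=itZ+u\bar Z$, where $t,u\in\mathbb{R}$ and $u<-t<2u$. Let $h(z,\bar z)=i(z+i\bar z)(z\bar z-u)$, and let $\gamma=\{\gamma_{ij}\}_{i,j\ge0}$ be the recursive doubly indexed sequence (RDIS) with initial conditions $\{\gamma_{ij}\}_{0\le i\le j\le2}$ (taken from $\omega$) and characteristic polynomial $P(z,\bar z)=z^3-itz-u\bar z$. Then the following are equivalent: (i) there exists a representing measure for $\omega$; (ii) there exists a representing measure for $\gamma$; (iii) $\Lambda_\omega(h)=0$ and $\Lambda_\omega(zh)=0$; (iv) $\operatorname{Re}\gamma_{12}+\operatorname{Im}\gamma_{12}=u(\operatorname{Re}\gamma_{01}+\operatorname{Im}\gamma_{01})$ and $\gamma_{22}=(u-t)\gamma_{11}+2u\operatorname{Im}\gamma_{02}$; (v) $h\in\mathcal{P}_\gamma$; (vi) the columns of $M(\omega)(3)$ satisfy $Z^2\bar Z+iZ\bar Z^2-uZ-iu\bar Z=0$.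
   Context: $i$ in coefficients is the imaginary unit. $M(\omega)(3)$ is the matrix with rows and columns indexed by the monomials $\bar z^pz^q$, $p+q\le3$, whose entry in row $\bar z^kz^l$, column $\bar z^pz^q$ is $\gamma_{p+l,q+k}$; its column indexed by $\bar z^pz^q$ is denoted $\bar Z^pZ^q$. $\ge0$ means positive semidefinite. $\Lambda_\omega$ is the linear functional on polynomials in $z,\bar z$ of total degree $\le6$ with $\Lambda_\omega(\bar z^pz^q)=\gamma_{pq}$. A representing measure for a (finite or infinite) family $\{\gamma_{pq}\}$ is a positive Borel measure $\mu$ on $\mathbb{C}$ with $\gamma_{pq}=\int\bar z^pz^q\,d\mu$ for all indices $(p,q)$ of the family. The RDIS with initial conditions $\{\gamma_{pq}\}_{0\le p\le q\le s-1}$ and characteristic polynomial $z^s-\sum_{0\le l+k\le s-1}a_{lk}\bar z^lz^k$ is the (unique) sequence $\{\gamma_{pq}\}_{p,q\ge0}$ having these initial values and satisfying $\gamma_{qp}=\overline{\gamma_{pq}}$ and $\gamma_{p,q+s}=\sum_{0\le l+k\le s-1}a_{lk}\gamma_{p+l,q+k}$ for all $p,q\ge0$. $\mathcal{P}_\gamma$ is the set of characteristic polynomials of $\gamma$: all $g=\sum g_{lk}\bar z^lz^k$ ($z,\bar z$ commuting indeterminates) with $\sum g_{lk}\gamma_{p+l,q+k}=0$ for all $p,q\ge0$. *)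

(* Defs.v *)
From mathcomp Require Import all_boot all_order all_algebra.
From mathcomp Require Import complex zify.
From mathcomp Require Import all_classical all_reals all_analysis.

Set Implicit Arguments.
Unset Strict Implicit.
Unset Printing Implicit Defensive.

Import Order.TTheory GRing.Theory Num.Theory.
Import numFieldNormedType.Exports.
Local Open Scope classical_set_scope.
Local Open Scope ring_scope.
Local Open Scope sesquilinear_scope.
Local Open Scope complex_scope.

(** ** Representing measures *)

Definition borelC (R : realType) :=
  g_sigma_algebraType (@open (R[i] : numClosedFieldType)).

Definition cintegrable (R : realType)
    (mu : {measure set (borelC R) -> \bar R}) (f : borelC R -> R[i]) : Prop :=
  mu.-integrable setT (fun z => (complex.Re (f z))%:E) /\
  mu.-integrable setT (fun z => (complex.Im (f z))%:E).

Definition cintegral (R : realType)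
    (mu : {measure set (borelC R) -> \bar R}) (f : borelC R -> R[i]) : R[i] :=
  Rintegral mu setT (fun z => complex.Re (f z)) +i*
  Rintegral mu setT (fun z => complex.Im (f z)).

Definition zmonom (R : realType) (p q : nat) (z : borelC R) : R[i] :=
  (z : R[i])^* ^+ p * (z : R[i]) ^+ q.

(* A finite family, e.g. (g p q) for p + q <= 6, is encoded as a total
   sequence g together with its set D of meaningful indices. *)
Definition representing_measure (R : realType) (D : set (nat * nat))
    (g : nat -> nat -> R[i]) (mu : {measure set (borelC R) -> \bar R}) : Prop :=
  forall p q, D (p, q) ->
    cintegrable mu (zmonom p q) /\ g p q = cintegral mu (zmonom p q).

(** ** Moment matrices *)

(* The pair (p, q) stands for the monomial zbar^p z^q. *)
Definition mono (n : nat) : finType :=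
  {m : 'I_n.+1 * 'I_n.+1 | (m.1 + m.2 <= n)%N}.

Definition mono1 (n : nat) : mono n :=
  Sub ((ord0, ord0) : 'I_n.+1 * 'I_n.+1) (isT : (0 + 0 <= n)%N).

(* Meaningful only for p + q <= n. *)
Definition mon (n p q : nat) : mono n := insubd (mono1 n) (inord p, inord q).

Definition moment_matrix (R : realType) (n : nat) (g : nat -> nat -> R[i]) :
    'M[R[i]]_#|{: mono n}| :=
  \matrix_(r < #|{: mono n}|, c < #|{: mono n}|)
    let: (k, l) := val (enum_val r : mono n) in
    let: (p, q) := val (enum_val c : mono n) in
    g (p + l)%N (q + k)%N.

(* The column indexed by zbar^p z^q, for p + q <= n. *)
Definition mcol (R : realType) (n : nat) (M : 'M[R[i]]_#|{: mono n}|)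
    (p q : nat) : 'cV[R[i]]_#|{: mono n}| :=
  col (enum_rank (mon n p q)) M.

(* In R[i], [0 <= x] entails that x is real. *)
Definition psdmx (R : realType) (n : nat) (M : 'M[R[i]]_n) : Prop :=
  forall v : 'cV[R[i]]_n, 0 <= (v ^t* *m M *m v) ord0 ord0.

(** ** Polynomials in z and zbar *)

(* In {poly {poly R[i]}}, the outer variable 'X stands for z and the inner one
   'Y = 'X%:P for zbar: g`_k`_l is the coefficient of zbar^l z^k in g. *)

Definition Lambda (R : realType) (w : nat -> nat -> R[i])
    (g : {poly {poly R[i]}}) : R[i] :=
  \sum_(k < size g) \sum_(l < size g`_k) g`_k`_l * w l k.

Definition char_polys (R : realType) (g : nat -> nat -> R[i]) :
    set {poly {poly R[i]}} :=
  [set f | forall p q, Lambda (fun l k => g (p + l)%N (q + k)%N) f = 0].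

(** ** Recursive doubly indexed sequences *)

(* Only the values (g0 p q) with p <= q < s are used. *)
Definition is_rdis (R : realType) (s : nat) (P : {poly {poly R[i]}})
    (g0 g : nat -> nat -> R[i]) : Prop :=
  exists2 a : nat -> nat -> R[i],
    P = 'X^s - \sum_(m : 'I_s * 'I_s | (m.1 + m.2 < s)%N)
                 (a m.1 m.2)%:P%:P * 'Y ^+ m.1 * 'X ^+ m.2 &
    [/\ forall p q, (p <= q < s)%N -> g p q = g0 p q,
        forall p q, g q p = (g p q)^* &
        forall p q, g p (q + s)%N =
          \sum_(m : 'I_s * 'I_s | (m.1 + m.2 < s)%N)
             a m.1 m.2 * g (p + m.1)%N (q + m.2)%N].

Section RdisExistence.
Context (R : realType) (s : nat) (a g0 : nat -> nat -> R[i]).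
Hypothesis g0_real : forall p, (p < s)%N -> (g0 p p)^* = g0 p p.

Let step (g : nat -> nat -> R[i]) p q :=
  \sum_(m : 'I_s * 'I_s | (m.1 + m.2 < s)%N)
     a m.1 m.2 * g (p + m.1)%N (q + m.2)%N.

Let step_eq g g' p q :
  (forall p' q', (p' + q' < p + q + s)%N -> g p' q' = g' p' q') ->
  step g p q = step g' p q.
Proof. by move=> H; apply: eq_bigr => m ms; rewrite H //; lia. Qed.

Fixpoint rdis_rec (n p q : nat) : R[i] :=
  if n is n'.+1 then
    if (s <= q)%N then step (rdis_rec n') p (q - s)
    else if (s <= p)%N then (step (rdis_rec n') q (p - s))^*
    else if (p <= q)%N then g0 p q else (g0 q p)^*
  else 0.

Let rdis_rec_fuel n m p q : (p + q < n)%N -> (p + q < m)%N ->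
  rdis_rec n p q = rdis_rec m p q.
Proof.
elim: n m p q => // n IHn [//|m] p q Hn Hm /=.
case: leqP => [sq|_]; first by apply: step_eq => p' q' H; apply: IHn; lia.
case: leqP => [sp|_] //; congr (_^*).
by apply: step_eq => p' q' H; apply: IHn; lia.
Qed.

Let rdis p q := rdis_rec (p + q).+1 p q.

Let rdis_stepr p q : rdis p (q + s) = step rdis p q.
Proof.
rewrite [LHS]/rdis [LHS]/= leq_addl addnK; apply: step_eq => p' q' H.
by apply: rdis_rec_fuel; lia.
Qed.

Let rdis_stepl p q : (q < s)%N -> rdis (p + s) q = (step rdis q p)^*.
Proof.
move=> qs; rewrite [LHS]/rdis [LHS]/= leqNgt qs /= leq_addl addnK; congr (_^*).
by apply: step_eq => p' q' H; apply: rdis_rec_fuel; lia.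
Qed.

Let rdis_small p q : (p <= q < s)%N -> rdis p q = g0 p q.
Proof.
move=> /andP[pq qs]; rewrite /rdis /= leqNgt qs /= leqNgt.
by rewrite (leq_ltn_trans pq qs) /= pq.
Qed.

Let rdis_herm p q : rdis q p = (rdis p q)^*.
Proof.
have [n] := ubnP (p + q); elim: n p q => // n IHn p q Hn.
have [sq|qs] := leqP s q; have [sp|ps] := leqP s p.
- rewrite -(subnK sq) -(subnK sp) in Hn *.
  move: (p - s)%N (q - s)%N Hn => {sp sq}p {}q Hn; rewrite !rdis_stepr.
  rewrite [RHS](rmorph_sum (@conjc R)).
  transitivity (\sum_(m : 'I_s * 'I_s | (m.1 + m.2 < s)%N)
    \sum_(m' : 'I_s * 'I_s | (m'.1 + m'.2 < s)%N)
      a m.1 m.2 * ((a m'.1 m'.2)^* * rdis (q + m.1 + m'.2) (p + m.2 + m'.1))).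
    apply: eq_bigr => m ms; rewrite IHn; last by lia.
    rewrite -mulr_sumr; congr (_ * _).
    rewrite addnAC rdis_stepr [LHS](rmorph_sum (@conjc R)).
    apply: eq_bigr => m' ms'; rewrite rmorphM; congr (_ * _).
    by rewrite [in RHS]IHn //; lia.
  rewrite exchange_big; apply: eq_bigr => m ms.
  rewrite rmorphM /= -IHn; last by lia.
  rewrite addnAC rdis_stepr mulr_sumr; apply: eq_bigr => m' ms'.
  by rewrite mulrCA; congr (_ * (_ * rdis _ _)); lia.
- by rewrite -(subnK sq) rdis_stepl // rdis_stepr.
- by rewrite -(subnK sp) rdis_stepl // rdis_stepr conjcK.
- wlog pq : p q qs ps {Hn} / (p <= q)%N.
    move=> H; have [|/ltnW] := leqP p q; first exact: H.
    by move=> /H-> //; rewrite conjcK.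
  rewrite [in RHS]rdis_small ?pq //.
  move: pq; rewrite leq_eqVlt => /predU1P[<-|pq].
    by rewrite rdis_small ?leqnn // g0_real.
  by rewrite /rdis /= (leqNgt s p) ps (leqNgt s q) qs /= leqNgt pq.
Qed.

Lemma rdis_exists : exists g,
  is_rdis s ('X^s - \sum_(m : 'I_s * 'I_s | (m.1 + m.2 < s)%N)
             (a m.1 m.2)%:P%:P * 'Y ^+ m.1 * 'X ^+ m.2) g0 g.
Proof. by exists rdis, a. Qed.

End RdisExistence.

Lemma rdis_unique (R : realType) (s : nat) (P : {poly {poly R[i]}})
    (g0 g g' : nat -> nat -> R[i]) :
  is_rdis s P g0 g -> is_rdis s P g0 g' -> g = g'.
Proof.
move=> [a Pa [g_i g_h g_r]] [b Pb [g'_i g'_h g'_r]].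
have ab (m : 'I_s * 'I_s) : (m.1 + m.2 < s)%N -> a m.1 m.2 = b m.1 m.2.
  move=> ms; move: Pb; rewrite Pa => /addrI /oppr_inj.
  have coefE (c : nat -> nat -> R[i]) :
      (\sum_(m : 'I_s * 'I_s | (m.1 + m.2 < s)%N)
         (c m.1 m.2)%:P%:P * 'Y ^+ m.1 * 'X ^+ m.2)`_m.2`_m.1 = c m.1 m.2.
    rewrite !coef_sum (bigD1 m) //= big1 ?addr0 => [|m' /andP[_ m'm]].
      by rewrite -rmorphXn -rmorphM coefCM coefXn eqxx mulr1 coefCM coefXn eqxx mulr1.
    rewrite -rmorphXn -rmorphM coefCM coefXn; case: eqP => [e2|_]; last first.
      by rewrite mulr0 coef0.
    rewrite mulr1 coefCM coefXn; case: eqP => [e1|_]; last by rewrite mulr0.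
    case/negP: m'm; apply/eqP; case: m' m e1 e2 {ms} => [? ?] [? ?] /= e1 e2.
    by congr (_, _); apply: val_inj.
  by move/(congr1 (fun f : {poly {poly R[i]}} => f`_m.2`_m.1)); rewrite !coefE.
apply/funext => p; apply/funext => q.
have [n] := ubnP (p + q); elim: n p q => // n IHn.
suff H p q : (p <= q)%N -> (p + q < n.+1)%N -> g p q = g' p q.
  move=> p q Hn; have [pq|/ltnW qp] := leqP p q; first exact: H.
  by rewrite g_h g'_h H // addnC.
move=> pq Hn; have [sq|qs] := leqP s q; last by rewrite g_i ?g'_i ?pq.
rewrite -(subnK sq) g_r g'_r; apply: eq_bigr => m ms.
by rewrite ab // IHn //; lia.
Qed.

(* Main.v *)
(* In the real coordinates X = Re z + Im z and Y = Re z - Im z, the zero set of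
   P = z^3 - itz - u zbar consists of the seven points (0,0), (0,+-al) and
   (+-be,+-de), with al^2 = -2(t+u), be^2 = u + t/2 and de^2 = u - t/2; as
   z + i zbar = (1+i) X and z zbar = (X^2 + Y^2)/2, they are all zeros of h.

   A representing measure satisfies int |P|^2 = 0, hence is carried by the
   zeros of P, so that h integrates to 0.  Conversely, modulo P and its conjugate
   one has z^2 h = i(t-u) h and z zbar h = (t-u) h, so that (iii), which is (iv)
   in coordinates, kills every multiple of h; and then the moment functional
   is determined by its values on 1, X, Y, X^2, XY, Y^2, X^2 Y.  On the span of
   these seven monomials it is a combination of the evaluations at the seven
   points.  The weight at a point is nonnegative because, up to a positive
   factor, it is the value of the functional at the square of a cubic vanishing
   at the six other points. *)
Require Import Defs.
From mathcomp Require Import all_boot all_order all_algebra.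
From mathcomp Require Import complex ring lra zify.
From mathcomp Require Import all_classical all_reals all_analysis.
From mathcomp Require Import measurable_realfun.

Set Implicit Arguments.
Unset Strict Implicit.
Unset Printing Implicit Defensive.

Import Order.TTheory GRing.Theory Num.Theory.
Import numFieldNormedType.Exports.
Local Open Scope classical_set_scope.
Local Open Scope ring_scope.
Local Open Scope complex_scope.

(** * Integration on the complex plane *)

(** Open rays []r, +oo[] generate the Borel sets of [R], and their preimages are open: if [r < f z],
    the ball around [z] of radius [f z - r] stays in the preimage. *)
Lemma measurable_lipschitz (R : realType) (f : borelC R -> R) :
  (forall x y : R[i], `|f x - f y|%:C <= `|x - y|) -> measurable_fun setT f.
Proof.
move=> f_lip; apply: (measurability _ (RGenOInfty.measurableE R)) => //.
move=> _ [_ [r ->] <-]; rewrite setTI; apply: sub_sigma_algebra.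
rewrite openE => z /=; rewrite in_itv /= andbT => rz; apply/nbhs_ballP.
exists (f z - r)%:C; first by rewrite /= ltcR subr_gt0.
move=> y /=; rewrite /ball /= in_itv /= andbT => /(le_lt_trans (f_lip z y)).
by rewrite ltcR ltr_norml ltrD2l ltrN2 => /andP[].
Qed.

Lemma measurable_Re (R : realType) :
  measurable_fun setT (@complex.Re R : borelC R -> R).
Proof.
apply: measurable_lipschitz => -[a b] [c d] /=.
exact: le_trans (normc_ge_Re ((a - c) +i* (b - d))).
Qed.

Lemma measurable_Im (R : realType) :
  measurable_fun setT (@complex.Im R : borelC R -> R).
Proof.
apply: measurable_lipschitz => -[a b] [c d] /=.
(* The imaginary part is minus the real part after multiplication by ['i], which preserves the
   norm. *)
have := normc_ge_Re ('i * ((a - c) +i* (b - d)) : R[i]).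
rewrite normrM (_ : `|'i : R[i]| = 1) ?mul1r; last first.
  by rewrite normc_def /= expr0n expr1n add0r sqrtr1.
by rewrite /= mul0r sub0r mul1r normrN.
Qed.

(** Scaled Dirac masses are added one at a time. Nonnegative functions come first, since for them
    the integral is additive in the measure without any integrability condition; a general [f] is
    then the difference of its positive and negative parts. *)
Lemma atomic_measure (R : realType) d (T : measurableType d) (s : seq (R * T)) :
    all (fun a => 0 <= a.1) s ->
  exists mu : {measure set T -> \bar R}, forall f : T -> R,
    measurable_fun setT f ->
    mu.-integrable setT (EFin \o f) /\
    Rintegral mu setT f = \sum_(a <- s) a.1 * f a.2.
Proof.
move=> s_ge0.
have [mu mu_ge0] : exists mu : {measure set T -> \bar R}, forall f : T -> R,
    measurable_fun setT f -> (forall x, 0 <= f x) ->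
    (\int[mu]_x (f x)%:E = (\sum_(a <- s) a.1 * f a.2)%:E)%E.
  elim: s s_ge0 => [_|[c x] s IHs /= /andP[c_ge0 /IHs[mu IHmu]]].
    by exists mzero => f _ _; rewrite integral_measure_zero big_nil.
  exists (measure_add (mscale (NngNum c_ge0) (dirac x)) mu) => f mf f_ge0.
  have /measurable_EFinP mEf := mf.
  have Ef_ge0 y : [set: T] y -> (0 <= (f y)%:E)%E by rewrite lee_fin.
  rewrite ge0_integral_measure_add // ge0_integral_mscale // IHmu //.
  by rewrite integral_dirac // diracT mul1e big_cons EFinD EFinM.
have int_ge0 (f : T -> R) : measurable_fun setT f -> (forall x, 0 <= f x) ->
    mu.-integrable setT (EFin \o f).
  move=> mf f_ge0; apply/integrableP; split; first exact/measurable_EFinP.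
  under eq_integral do rewrite /= ger0_norm //.
  by rewrite mu_ge0 // ltry.
exists mu => f mf.
have mfp : measurable_fun setT (fun x => Num.max (f x) 0).
  exact: measurable_maxr.
have mfn : measurable_fun setT (fun x => Num.max (- f x) 0).
  by apply: measurable_maxr => //; exact: measurableT_comp.
have max_ge0 (y : R) : 0 <= Num.max y 0 by rewrite le_max lexx orbT.
have fE x : f x = Num.max (f x) 0 - Num.max (- f x) 0.
  by case: (lerP (f x) 0); case: (lerP (- f x) 0); lra.
have -> : f = fun x => Num.max (f x) 0 - Num.max (- f x) 0 by apply/funext.
have ip := int_ge0 _ mfp (fun=> max_ge0 _).
have ip' := int_ge0 _ mfn (fun=> max_ge0 _).
split; first by have := integrableB measurableT ip ip'; apply: eq_integrable.
rewrite RintegralB // /Rintegral (mu_ge0 _ mfp) // (mu_ge0 _ mfn) //= -sumrB.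
by apply: eq_bigr => a _; rewrite -mulrBr.
Qed.

(** Integrability travels with the value, because linearity of the value depends on it. *)
Definition has_cintegral (R : realType) (mu : {measure set (borelC R) -> \bar R})
    (f : borelC R -> R[i]) (v : R[i]) : Prop :=
  cintegrable mu f /\ cintegral mu f = v.

Section HasCintegral.
Context (R : realType) (mu : {measure set (borelC R) -> \bar R}).

Lemma has_cintegralD f g v w :
  has_cintegral mu f v -> has_cintegral mu g w ->
  has_cintegral mu (fun z => f z + g z) (v + w).
Proof.
move=> [[fr fi] <-] [[gr gi] <-].
have ReD (a b : R[i]) : complex.Re (a + b) = complex.Re a + complex.Re b.
  by case: a b => ? ? [].
have ImD (a b : R[i]) : complex.Im (a + b) = complex.Im a + complex.Im b.
  by case: a b => ? ? [].
split; first split.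
- have := integrableD measurableT fr gr; apply: eq_integrable => // z _ /=.
  by rewrite ReD.
- have := integrableD measurableT fi gi; apply: eq_integrable => // z _ /=.
  by rewrite ImD.
rewrite /cintegral; under eq_Rintegral do rewrite ReD.
rewrite RintegralD //; under [in X in _ +i* X = _]eq_Rintegral do rewrite ImD.
by rewrite RintegralD.
Qed.

Lemma has_cintegralZ c f v :
  has_cintegral mu f v -> has_cintegral mu (fun z => c * f z) (c * v).
Proof.
case: c => a b [[fr fi] <-].
have ReM (x : R[i]) :
    complex.Re ((a +i* b) * x) = a * complex.Re x + - b * complex.Im x.
  by case: x => x y /=; ring.
have ImM (x : R[i]) :
    complex.Im ((a +i* b) * x) = a * complex.Im x + b * complex.Re x.
  by case: x => x y /=; ring.
have ir k : mu.-integrable setT (fun z => (k * complex.Re (f z))%:E).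
  by have := integrableZl measurableT k fr; apply: eq_integrable.
have ii k : mu.-integrable setT (fun z => (k * complex.Im (f z))%:E).
  by have := integrableZl measurableT k fi; apply: eq_integrable.
split; first split.
- have := integrableD measurableT (ir a) (ii (- b)); apply: eq_integrable => // z _ /=.
  by rewrite ReM.
- have := integrableD measurableT (ii a) (ir b); apply: eq_integrable => // z _ /=.
  by rewrite ImM.
rewrite /cintegral; under eq_Rintegral do rewrite ReM.
rewrite (RintegralD _ (ir a) (ii (- b))) // !RintegralZl //.
under [in X in _ +i* X = _]eq_Rintegral do rewrite ImM.
rewrite (RintegralD _ (ii a) (ir b)) // !RintegralZl //.
by apply/eqP; rewrite eq_complex /= !mulNr !eqxx.
Qed.

Lemma eq_has_cintegral f g v w :
  f =1 g -> v = w -> has_cintegral mu f v -> has_cintegral mu g w.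
Proof. by move=> /funext-> ->. Qed.

(** The nonnegative function [|f|^2] has integral 0, so [f] vanishes almost everywhere, and with it
    [k]. *)
Lemma has_cintegral_eq0 f k v :
  has_cintegral mu (fun z => f z * (f z)^* ) 0 ->
  (forall z, f z = 0 -> k z = 0) -> has_cintegral mu k v -> v = 0.
Proof.
move=> [[fr fi] [f0 _]] fk [[kr ki] <-].
have ReE z : complex.Re (f z * (f z)^* ) =
    complex.Re (f z) ^+ 2 + complex.Im (f z) ^+ 2.
  by case: (f z) => a b /=; ring.
have Re_ge0 z : 0 <= complex.Re (f z * (f z)^* ).
  by rewrite ReE addr_ge0 ?sqr_ge0.
have ae0 : ae_eq mu setT (fun z => (complex.Re (f z * (f z)^* ))%:E) (cst 0%E).
  apply/ae_eq_integral_abs => //; first exact: measurable_int fr.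
  under eq_integral do rewrite /= ger0_norm //.
  by rewrite -(fineK (integrable_fin_num _ fr)) // -/(Rintegral _ _ _) f0.
(* Here [p] stands for the real or the imaginary part. *)
have kae0 (p : R[i] -> R) : p 0 = 0 ->
    mu.-integrable setT (fun z => (p (k z))%:E) ->
    Rintegral mu setT (fun z => p (k z)) = 0.
  move=> p0 ik; rewrite /Rintegral (ae_eq_integral (cst 0%E)) //.
  - by rewrite integral0.
  - exact: measurable_int ik.
  apply: filterS ae0 => z /(_ I) [/eqP].
  rewrite ReE paddr_eq0 ?sqr_ge0 // !sqrf_eq0 => /andP[/eqP r0 /eqP i0] _ /=.
  by rewrite fk ?p0 //; case: (f z) r0 i0 => a b /= -> ->.
by rewrite /cintegral !kae0.
Qed.

End HasCintegral.

(** * Moment sequences with the cubic recursion *)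

Section Cubic.
Context (R : realType).
Implicit Types (t u : R) (w g : nat -> nat -> R[i]).

Lemma coef_monomial (c : R[i]) l k i j :
  (c%:P%:P * 'Y ^+ l * 'X ^+ k)`_i`_j = if (i == k) && (j == l) then c else 0.
Proof.
rewrite -rmorphXn -rmorphM coefCM coefXn; case: eqP => _; last first.
  by rewrite mulr0 coef0.
rewrite mulr1 coefCM coefXn; case: eqP => _; first by rewrite mulr1.
by rewrite mulr0.
Qed.

Lemma is_rdis_cubic t u w g :
    is_rdis 3 ('X^3 - ('i%C * t%:C)%:P%:P * 'X - u%:C%:P%:P * 'Y) w g ->
  [/\ forall p q, (p <= q < 3)%N -> g p q = w p q,
      forall p q, g q p = conjc (g p q) &
      forall p q, g p q.+3 = 'i%C * t%:C * g p q.+1 + u%:C * g p.+1 q].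
Proof.
move=> [a Pa [g_init g_herm g_rec]]; split=> // p q.
pose b (l k : nat) : R[i] := match l, k with
  0, 1 => 'i%C * t%:C | 1, 0 => u%:C | _, _ => 0 end.
have sumE (V : nmodType) (F : nat -> nat -> V) :
    \sum_(m : 'I_3 * 'I_3 | (m.1 + m.2 < 3)%N) F m.1 m.2 =
    F 0%N 0%N + F 0%N 1%N + F 0%N 2%N + F 1%N 0%N + F 1%N 1%N + F 2%N 0%N.
  rewrite big_mkcond -(pair_bigA _ (fun i j : 'I_3 =>
    if (i + j < 3)%N then F i j else 0)) /=.
  by rewrite !big_ord_recl !big_ord0 /= !addr0 !addrA.
have coefE (c : nat -> nat -> R[i]) (m : 'I_3 * 'I_3) : (m.1 + m.2 < 3)%N ->
    (\sum_(m' : 'I_3 * 'I_3 | (m'.1 + m'.2 < 3)%N)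
      (c m'.1 m'.2)%:P%:P * 'Y ^+ m'.1 * 'X ^+ m'.2)`_m.2`_m.1 = c m.1 m.2.
  move=> m3; rewrite !coef_sum (bigD1 m) //= coef_monomial !eqxx.
  rewrite big1 ?addr0 // => -[i j] /andP[_ ijm].
  rewrite coef_monomial; case: ifP => // /andP[/eqP mj /eqP mi].
  by case/eqP: ijm; case: m mi mj {m3} => k l /= ki lj;
     congr (_, _); apply: val_inj.
have Qab : \sum_(m : 'I_3 * 'I_3 | (m.1 + m.2 < 3)%N)
      (a m.1 m.2)%:P%:P * 'Y ^+ m.1 * 'X ^+ m.2 =
    \sum_(m : 'I_3 * 'I_3 | (m.1 + m.2 < 3)%N)
      (b m.1 m.2)%:P%:P * 'Y ^+ m.1 * 'X ^+ m.2 :> {poly {poly R[i]}}.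
  move: Pa; rewrite -addrA -opprD => /addrI/oppr_inj <-.
  rewrite (sumE _ (fun l k => (b l k)%:P%:P * 'Y ^+ l * 'X ^+ k)) /=.
  rewrite !polyC0; move: (('i%C * t%:C)%:P%:P) (u%:C%:P%:P) 'X 'Y => A B Z W.
  ring.
have ab (m : 'I_3 * 'I_3) (m3 : (m.1 + m.2 < 3)%N) : a m.1 m.2 = b m.1 m.2 :=
  etrans (esym (coefE a m m3))
    (etrans (congr1 (fun f : {poly {poly R[i]}} => f`_m.2`_m.1) Qab) (coefE b m m3)).
rewrite -[q.+3]addn3 g_rec (eq_bigr _ (fun m m3 => congr1 ( *%R^~ _) (ab m m3))).
rewrite (sumE _ (fun l k => b l k * g (p + l)%N (q + k)%N)) /=.
by rewrite !mul0r !add0r !addr0 !addn0 !addn1.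
Qed.

(** The ranges of summation in [Lambda] depend on the polynomial; a common bound makes the sums of
    different polynomials comparable term by term. *)
Lemma Lambda_bound w n (f : {poly {poly R[i]}}) :
    (size f <= n)%N -> (forall k, (size (f`_k)%R <= n)%N) ->
  Lambda w f = \sum_(k < n) \sum_(l < n) f`_k`_l * w l k.
Proof.
move=> fn fkn; rewrite /Lambda.
rewrite (big_ord_widen n (fun k => \sum_(l < size f`_k) f`_k`_l * w l k) fn).
rewrite big_mkcond; apply: eq_bigr => k _; case: ltnP => [kf|fk]; last first.
  by rewrite big1 // => l _; rewrite (nth_default _ fk) coef0 mul0r.
rewrite (big_ord_widen n (fun l => f`_k`_l * w l k) (fkn k)) big_mkcond.
apply: eq_bigr => l _.
by case: ltnP => // fl; rewrite nth_default ?mul0r.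
Qed.

Lemma LambdaD w f1 f2 : Lambda w (f1 + f2) = Lambda w f1 + Lambda w f2.
Proof.
pose b (f : {poly {poly R[i]}}) := (size f + \sum_(k < size f) size (f`_k)%R)%N.
have bP (f : {poly {poly R[i]}}) :
    (size f <= b f)%N /\ forall k, (size (f`_k)%R <= b f)%N.
  split=> [|k]; first exact: leq_addr.
  case: (ltnP k (size f)) => kf; last by rewrite nth_default // size_poly0.
  by rewrite /b (bigD1 (Ordinal kf)) //= addnCA leq_addr.
pose n := (b f1 + b f2 + b (f1 + f2)%R)%N.
have LE (f : {poly {poly R[i]}}) : (b f <= n)%N ->
    Lambda w f = \sum_(k < n) \sum_(l < n) f`_k`_l * w l k.
  move=> bn; have [f_le fk_le] := bP f.
  by apply: Lambda_bound => [|k]; apply: leq_trans bn.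
rewrite !LE; try by rewrite /n; lia.
rewrite -big_split; apply: eq_bigr => k _; rewrite -big_split.
by apply: eq_bigr => l _; rewrite !coefD mulrDl.
Qed.

Lemma Lambda_monomial w c l k :
  Lambda w (c%:P%:P * 'Y ^+ l * 'X ^+ k) = c * w l k.
Proof.
pose n := (k + l).+1; have kn : (k < n)%N by rewrite ltnS leq_addr.
have ln : (l < n)%N by rewrite ltnS leq_addl.
rewrite (@Lambda_bound w n); first last.
- move=> i; apply/leq_sizeP => j nj; rewrite coef_monomial.
  by rewrite (gtn_eqF (leq_trans ln nj)) andbF.
- apply/leq_sizeP => i ni; apply/polyP => j; rewrite coef_monomial coef0.
  by rewrite (gtn_eqF (leq_trans kn ni)).
rewrite (bigD1 (Ordinal kn)) //= (bigD1 (Ordinal ln)) //= coef_monomial !eqxx.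
rewrite !big1 ?addr0 // => [i ik|j jl]; last first.
  by rewrite coef_monomial (negPf (_ : j != l :> nat)) ?andbF ?mul0r.
by rewrite big1 // => j _; rewrite coef_monomial (negPf (_ : i != k :> nat)) ?mul0r.
Qed.

(* The value at [zbar^p z^q h] of the functional with moments [g]. *)
Definition hmoment u g p q : R[i] :=
  'i%C * g p.+1 q.+2 - g p.+2 q.+1 - 'i%C * u%:C * g p q.+1 + u%:C * g p.+1 q.

Lemma Lambda_h w u :
  Lambda w ('i%C%:P%:P * ('X + 'i%C%:P%:P * 'Y) * ('X * 'Y - u%:C%:P%:P)) =
  hmoment u w 0 0.
Proof.
have i2 : 'i%C%:P%:P * 'i%C%:P%:P = -1 :> {poly {poly R[i]}}.
  by rewrite -!rmorphM -expr2 sqr_i !rmorphN1.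
rewrite (_ : _ * _ = 'i%C%:P%:P * 'Y ^+ 1 * 'X ^+ 2
  + (-1)%:P%:P * 'Y ^+ 2 * 'X ^+ 1 + (- ('i%C * u%:C))%:P%:P * 'Y ^+ 0 * 'X ^+ 1
  + u%:C%:P%:P * 'Y ^+ 1 * 'X ^+ 0); last first.
  rewrite !polyCN !polyCM; move: i2.
  by move: ('i%C%:P%:P) (u%:C%:P%:P) 'X ('Y) => I U Z W i2; ring: i2.
by rewrite !LambdaD !Lambda_monomial /hmoment; ring.
Qed.

Lemma Lambda_zh w u :
  Lambda w ('X * ('i%C%:P%:P * ('X + 'i%C%:P%:P * 'Y)
            * ('X * 'Y - u%:C%:P%:P))) = hmoment u w 0 1.
Proof.
have i2 : 'i%C%:P%:P * 'i%C%:P%:P = -1 :> {poly {poly R[i]}}.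
  by rewrite -!rmorphM -expr2 sqr_i !rmorphN1.
rewrite (_ : _ * _ = 'i%C%:P%:P * 'Y ^+ 1 * 'X ^+ 3
  + (-1)%:P%:P * 'Y ^+ 2 * 'X ^+ 2 + (- ('i%C * u%:C))%:P%:P * 'Y ^+ 0 * 'X ^+ 2
  + u%:C%:P%:P * 'Y ^+ 1 * 'X ^+ 1); last first.
  rewrite !polyCN !polyCM; move: i2.
  by move: ('i%C%:P%:P) (u%:C%:P%:P) 'X ('Y) => I U Z W i2; ring: i2.
by rewrite !LambdaD !Lambda_monomial /hmoment; ring.
Qed.

Lemma conjcE :
  (forall a b : R[i], conjc (a + b) = conjc a + conjc b) *
  (forall a b : R[i], conjc (a * b) = conjc a * conjc b) *
  (forall a : R[i], conjc (- a) = - conjc a) *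
  (conjc ('i%C : R[i]) = - 'i%C) * (forall x : R, conjc x%:C = x%:C).
Proof.
by do ?split=> *; rewrite ?rmorphD ?rmorphM ?rmorphN //;
  apply/eqP; rewrite eq_complex /= oppr0 !eqxx.
Qed.

Lemma mulii : 'i%C * 'i%C = -1 :> R[i].
Proof. by rewrite -expr2 sqr_i. Qed.

(** * Reduction of the moments of the multiples of h *)

Section HfunRec.
Context t u g.
Hypothesis g_herm : forall p q, g q p = conjc (g p q).
Hypothesis g_rec : forall p q,
  g p q.+3 = 'i%C * t%:C * g p q.+1 + u%:C * g p.+1 q.

Let g_recl p q : g p.+3 q = - 'i%C * t%:C * g p.+1 q + u%:C * g p q.+1.
Proof. by rewrite g_herm g_rec !conjcE -!g_herm. Qed.

(** The polynomial [h] equals [- i] times its own conjugate. *)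
Lemma hmoment_herm p q : hmoment u g q p = - 'i%C * conjc (hmoment u g p q).
Proof.
have i2 := mulii.
by rewrite /hmoment !conjcE -!g_herm; ring: i2.
Qed.

Lemma hmoment_z2 p q : hmoment u g p q.+2 = 'i%C * (t - u)%:C * hmoment u g p q.
Proof. have i2 := mulii; by rewrite /hmoment !(g_rec, g_recl); ring: i2. Qed.

Lemma hmoment_zzbar p q : hmoment u g p.+1 q.+1 = (t - u)%:C * hmoment u g p q.
Proof. have i2 := mulii; by rewrite /hmoment !(g_rec, g_recl); ring: i2. Qed.

(** Symmetry gives [p <= q]; the factor [z zbar] then lowers [p] to 0, and the factor [z^2] lowers
    [q] to 0 or 1. *)
Lemma hmoment_eq0 : hmoment u g 0 0 = 0 -> hmoment u g 0 1 = 0 ->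
  forall p q, hmoment u g p q = 0.
Proof.
move=> h00 h01 p q; wlog pq : p q / (p <= q)%N.
  move=> H; have [/H//|/ltnW/H h_qp] := leqP p q.
  by rewrite hmoment_herm h_qp conjc0 mulr0.
elim: p q pq => [|p IHp] [|q] //.
  move=> _; elim/ltn_ind: q => -[|[|q]] IHq //.
    by rewrite hmoment_z2 h00 mulr0.
  by rewrite hmoment_z2 IHq ?mulr0.
by rewrite ltnS hmoment_zzbar => /IHp->; rewrite mulr0.
Qed.

End HfunRec.

(** By symmetry [p <= q], and the recursion expresses an entry through entries whose total degree is
    smaller by 2, so induction on the degree ends at the initial values. The bound [n] lets the
    lemma apply to truncated data as well as to full sequences. *)
Lemma eq_trunc_cubic_seq t u n w g :
    (forall i j, (i + j <= n)%N -> w j i = conjc (w i j)) ->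
    (forall p q, (p + q.+3 <= n)%N ->
       w p q.+3 = 'i%C * t%:C * w p q.+1 + u%:C * w p.+1 q) ->
    (forall p q, g q p = conjc (g p q)) ->
    (forall p q, g p q.+3 = 'i%C * t%:C * g p q.+1 + u%:C * g p.+1 q) ->
    (forall p q, (p <= q < 3)%N -> (p + q <= n)%N -> g p q = w p q) ->
  forall p q, (p + q <= n)%N -> g p q = w p q.
Proof.
move=> wh wr gh gr gw p q.
have [m] := ubnP (p + q); elim: m p q => // m IHm p q.
wlog pq : p q / (p <= q)%N => [H pqm pqn|].
  have [pq|/ltnW qp] := leqP p q; first exact: H.
  by rewrite gh wh ?H // addnC.
case: q pq => [|[|[|q]]] pq pqm pqn; try by rewrite gw ?pq.
by rewrite gr wr // !IHm //; lia.
Qed.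

(** * Entries and quadratic form of the moment matrix *)

Section MomentMatrix.
Context (n : nat) (w : nat -> nat -> R[i]).

Lemma val_mon p q : (p + q <= n)%N -> val (mon n p q) = (inord p, inord q).
Proof.
by move=> pqn; rewrite /mon insubdK //= unfold_in /= !inordK //; lia.
Qed.

Lemma mcolE (m : mono n) p q : (p + q <= n)%N ->
  mcol (moment_matrix n w) p q (enum_rank m) ord0 =
  w (p + (val m).2)%N (q + (val m).1)%N.
Proof.
move=> pqn; rewrite !mxE !enum_rankK val_mon //.
by case: (val m) => k l /=; rewrite !inordK //; lia.
Qed.

Lemma mcol_mon k l p q : (p + q <= n)%N -> (k + l <= n)%N ->
  mcol (moment_matrix n w) p q (enum_rank (mon n k l)) ord0 =
  w (p + l)%N (q + k)%N.
Proof. by move=> pqn kln; rewrite mcolE // val_mon //= !inordK //; lia. Qed.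

(** For [p] the polynomial with coefficients [f], the double sum is the moment functional at
    [|p|^2]. It is the quadratic form of the matrix, reindexed by monomials. *)
Lemma psdmx_ge0 (f : mono n -> R[i]) : psdmx (moment_matrix n w) ->
  0 <= \sum_m \sum_m' conjc (f m) * f m' *
     w ((val m').1 + (val m).2)%N ((val m').2 + (val m).1)%N.
Proof.
move=> /(_ (\col_i f (enum_val i))); congr (0 <= _).
have enum_bij : {on [pred _ | true], bijective (@enum_val (mono n) (mem predT))}.
  exact: onW_bij (enum_val_bij _).
rewrite exchange_big mxE (reindex _ enum_bij) /=; apply: eq_bigr => j _.
rewrite mxE mulr_suml (reindex _ enum_bij) /=; apply: eq_bigr => i _.
rewrite !mxE mulrAC /=.
by case: (sval (enum_val i)) (sval (enum_val j)) => k l [p q].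
Qed.

End MomentMatrix.

Lemma zmonom_conj p q (z : R[i]) : zmonom q p z = conjc (zmonom p q z).
Proof. by rewrite /zmonom [RHS]rmorphM !rmorphXn /= conjcK mulrC. Qed.

Lemma zmonomD p q p' q' (z : R[i]) :
  zmonom (p + p') (q + q') z = zmonom p q z * zmonom p' q' z.
Proof. by rewrite /zmonom !exprD mulrACA. Qed.

(** The sum is again the functional at [|p|^2], now computed from the atoms. The weights have
    unknown sign here: the inequality serves to test them. *)
Lemma psdmx_atoms n w (s : seq (R * R[i])) (f : mono n -> R[i]) :
    psdmx (moment_matrix n w) ->
    (forall p q, (p + q <= n + n)%N ->
       w p q = \sum_(a <- s) a.1%:C * zmonom p q a.2) ->
  0 <= \sum_(a <- s) a.1%:C *
    (conjc (\sum_m f m * zmonom (val m).1 (val m).2 a.2) *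
     \sum_m f m * zmonom (val m).1 (val m).2 a.2).
Proof.
move=> /(psdmx_ge0 f) w_ge0 ws; congr (0 <= _): w_ge0.
transitivity (\sum_m \sum_m' \sum_(a <- s) a.1%:C * (conjc (f m) * f m' *
    (conjc (zmonom (val m).1 (val m).2 a.2) * zmonom (val m').1 (val m').2 a.2))).
  apply: eq_bigr => m _; apply: eq_bigr => m' _; rewrite ws; last first.
    by have := valP m; have := valP m'; rewrite /=; lia.
  rewrite mulr_sumr; apply: eq_bigr => a _; rewrite mulrCA; congr (_ * (_ * _)).
  by rewrite zmonomD -zmonom_conj mulrC.
under eq_bigr do rewrite exchange_big.
rewrite exchange_big; apply: eq_bigr => a _.
rewrite [conjc _]rmorph_sum mulr_suml mulr_sumr.
apply: eq_bigr => m _; rewrite !mulr_sumr; apply: eq_bigr => m' _.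
by rewrite [RHS]/= !conjcE; congr (_ * _); rewrite mulrACA.
Qed.

(** Polynomial functions in [z] and [zbar] of total degree at most [n], with the coefficient family
    in the form that [psdmx_atoms] takes. *)
Definition polyfun n (f : R[i] -> R[i]) : Prop :=
  exists c : mono n -> R[i],
    forall z, f z = \sum_m c m * zmonom (val m).1 (val m).2 z.

Lemma polyfunD n f1 f2 :
  polyfun n f1 -> polyfun n f2 -> polyfun n (fun z => f1 z + f2 z).
Proof.
move=> [c1 f1E] [c2 f2E]; exists (fun m => c1 m + c2 m) => z.
by rewrite f1E f2E -big_split; apply: eq_bigr => m _; rewrite mulrDl.
Qed.

Lemma polyfunZ n c f : polyfun n f -> polyfun n (fun z => c * f z).
Proof.
move=> [d fE]; exists (fun m => c * d m) => z.
by rewrite fE mulr_sumr; apply: eq_bigr => m _; rewrite mulrA.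
Qed.

Lemma polyfun_zmonom n p q : (p + q <= n)%N -> polyfun n (zmonom p q).
Proof.
move=> pqn; exists (fun m => (m == mon n p q)%:R) => z.
rewrite (bigD1 (mon n p q)) //= eqxx mul1r val_mon //= !inordK; try lia.
by rewrite big1 ?addr0 // => m /negPf->; rewrite mul0r.
Qed.

Lemma eq_polyfun n f1 f2 : f1 =1 f2 -> polyfun n f1 -> polyfun n f2.
Proof. by move=> /funext->. Qed.

Lemma polyfun_sum n (I : Type) (r : seq I) (F : I -> R[i] -> R[i]) :
  (forall i, polyfun n (F i)) -> polyfun n (fun z => \sum_(i <- r) F i z).
Proof.
move=> nF; elim: r => [|i r IHr].
  apply: (@eq_polyfun n (fun z => 0 * zmonom 0 0 z)) => [z|].
    by rewrite big_nil mul0r.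
  exact/polyfunZ/polyfun_zmonom.
apply: (@eq_polyfun n (fun z => F i z + \sum_(j <- r) F j z)) => [z|].
  by rewrite big_cons.
exact: polyfunD.
Qed.

Lemma polyfunM n1 n2 f1 f2 :
  polyfun n1 f1 -> polyfun n2 f2 -> polyfun (n1 + n2) (fun z => f1 z * f2 z).
Proof.
move=> [c1 f1E] [c2 f2E].
apply: (@eq_polyfun _ (fun z => \sum_m1 \sum_m2 c1 m1 * (c2 m2 *
    zmonom ((val m1).1 + (val m2).1) ((val m1).2 + (val m2).2) z))) => [z|].
  rewrite f1E f2E mulr_suml; apply: eq_bigr => m1 _.
  by rewrite mulr_sumr; apply: eq_bigr => m2 _; rewrite zmonomD; ring.
apply: polyfun_sum => m1; apply: polyfun_sum => m2.
apply/polyfunZ/polyfunZ/polyfun_zmonom.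
by have := valP m1; have := valP m2; rewrite /=; lia.
Qed.

End Cubic.

(** * Nullity of h for measures *)

Section HMoments.
Context (R : realType).
Implicit Types (t u : R) (w g : nat -> nat -> R[i]) (z : R[i]).

(** Under the symmetry of [w], the real and imaginary parts of the moment are opposite, so its
    vanishing is one real equation. *)
Lemma hmoment00E u w : w 2%N 1%N = conjc (w 1%N 2%N) ->
    w 1%N 0%N = conjc (w 0%N 1%N) ->
  (hmoment u w 0 0 = 0) <->
  (complex.Re (w 1%N 2%N) + complex.Im (w 1%N 2%N) =
    u * (complex.Re (w 0%N 1%N) + complex.Im (w 0%N 1%N))).
Proof.
rewrite /hmoment => -> ->; case: (w 1%N 2%N) (w 0%N 1%N) => a b [c d] /=.
split=> [/eqP|e]; last apply/eqP; rewrite eq_complex /=.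
  by move=> /andP[/eqP h1 _]; lra.
by apply/andP; split; apply/eqP; lra.
Qed.

Lemma hmoment01E t u w : w 2%N 0%N = conjc (w 0%N 2%N) ->
    w 1%N 3%N = 'i%C * t%:C * w 1%N 1%N + u%:C * w 2%N 0%N ->
  (hmoment u w 0 1 = 0) <->
  (w 2%N 2%N = (u - t)%:C * w 1%N 1%N + (2 * u * complex.Im (w 0%N 2%N))%:C).
Proof.
move=> w20 w13; have i2 := @mulii R.
(* The recursion turns [i w13] into [- t w11 + i u w20], and [i u (w20 - w02)] is [2 u Im w02]. *)
suff -> : hmoment u w 0 1 = (u - t)%:C * w 1%N 1%N +
    (2 * u * complex.Im (w 0%N 2%N))%:C - w 2%N 2%N.
  by split=> [/eqP|->]; rewrite ?subrr // subr_eq0 => /eqP.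
rewrite /hmoment w13 w20; case: (w 0%N 2%N) (w 1%N 1%N) (w 2%N 2%N).
by move=> a b [c d] [e f]; apply/eqP; rewrite eq_complex /=; apply/andP; split;
  apply/eqP; ring.
Qed.

Lemma zmonom_rec t u z : z ^+ 3 = 'i%C * t%:C * z + u%:C * conjc z ->
  forall p q, zmonom p q.+3 z =
    'i%C * t%:C * zmonom p q.+1 z + u%:C * zmonom p.+1 q z.
Proof.
move=> z3 p q; rewrite /zmonom -addn3 exprD z3 !exprS.
by rewrite -[(z : R[i])^*]/(conjc z); ring.
Qed.

(** The moments of a unit mass at a zero [z] of P obey the recursion, hence
    [|z|^2 h(z) = (t - u) h(z)]. As [t - u < 0], this forces [h(z) = 0]. *)
Lemma hmoment_zmonom t u z p q : t - u < 0 ->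
    z ^+ 3 = 'i%C * t%:C * z + u%:C * conjc z ->
  hmoment u (fun p q => zmonom p q z) p q = 0.
Proof.
move=> tu z3; pose h := hmoment u (fun p q => zmonom p q z).
have hE i j : h i j = zmonom i j z * h 0%N 0%N.
  by rewrite /h /hmoment /zmonom !exprS; ring.
suff h0 : h 0%N 0%N = 0 by rewrite -/(h p q) hE h0 mulr0.
have /eqP := hmoment_zzbar (fun p q => zmonom_conj p q z) (zmonom_rec z3) 0 0.
rewrite -/(h _ _) -/(h _ _) hE -subr_eq0 -mulrBl mulf_eq0.
rewrite (_ : zmonom _ _ _ = `|z| ^+ 2); last by rewrite sqr_normc mulrC.
rewrite subr_eq0 normc_def -rmorphXn => /orP[/eqP[e]|/eqP//].
have := sqr_ge0 (Num.sqrt (complex.Re z ^+ 2 + complex.Im z ^+ 2)).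
by rewrite e leNgt tu.
Qed.

(** Since [|P|^2] has degree 6, its integral is already determined by the moments of degree at most
    6. Any larger index set [D] is allowed, so that both the truncated and the full sequence are
    covered. *)
Lemma representing_measure_hmoment t u w (D : set (nat * nat))
    (mu : {measure set (borelC R) -> \bar R}) : t - u < 0 ->
    [set pq | (pq.1 + pq.2 <= 6)%N] `<=` D ->
    (forall p q, (p + q.+3 <= 6)%N ->
       w p q.+3 = 'i%C * t%:C * w p q.+1 + u%:C * w p.+1 q) ->
  representing_measure D w mu -> hmoment u w 0 0 = 0 /\ hmoment u w 0 1 = 0.
Proof.
move=> tu D6 w_rec mu_w; have i2 := @mulii R.
have mom p q c : (p + q <= 6)%N ->
    has_cintegral mu (fun z => c * zmonom p q z) (c * w p q).
  move=> pq6; apply: has_cintegralZ.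
  by have [? ->] := mu_w p q (D6 (p, q) pq6).
pose P (z : borelC R) : R[i] := zmonom 0 3 z +
  - ('i%C * t%:C) * zmonom 0 1 z + - u%:C * zmonom 1 0 z.
have PJ z : conjc (P z) = zmonom 3 0 z + 'i%C * t%:C * zmonom 1 0 z
    + - u%:C * zmonom 0 1 z.
  have conjP (a b c : R[i]) :
      conjc (a + - ('i%C * t%:C) * b + - u%:C * c) =
      conjc a + 'i%C * t%:C * conjc b + - u%:C * conjc c.
    by rewrite !conjcE; ring.
  by rewrite conjP -!zmonom_conj.
have P0 : has_cintegral mu (fun z => P z * conjc (P z)) 0.
  have := has_cintegralD (mom 3 3 1 isT) (has_cintegralD
    (mom 1 3 ('i%C * t%:C) isT) (has_cintegralD
    (mom 0 4 (- u%:C) isT) (has_cintegralD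
    (mom 3 1 (- ('i%C * t%:C)) isT) (has_cintegralD
    (mom 1 1 (t%:C ^+ 2 + u%:C ^+ 2) isT) (has_cintegralD
    (mom 0 2 ('i%C * t%:C * u%:C) isT) (has_cintegralD
    (mom 4 0 (- u%:C) isT)
    (mom 2 0 (- ('i%C * t%:C * u%:C)) isT))))))).
  apply: eq_has_cintegral => [z|].
    rewrite PJ /P /zmonom; ring: i2.
  (* Once [w33], [w13] and [w04] are eliminated, the integral of the expanded [|P|^2] cancels. *)
  rewrite (w_rec 3 0) // (w_rec 1 0) // (w_rec 0 1) //; ring: i2.
have Ph p q (z : borelC R) : P z = 0 -> hmoment u (fun p q => zmonom p q z) p q = 0.
  move=> Pz; apply: (hmoment_zmonom _ _ tu); apply/eqP; rewrite -subr_eq0 -Pz.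
  by apply/eqP; rewrite /P /zmonom !(expr0, expr1) -[(z : R[i])^*]/(conjc z); ring.
have hmoment_int p q : (p + q <= 3)%N ->
    has_cintegral mu (fun z => hmoment u (fun p q => zmonom p q z) p q) (hmoment u w p q).
  move=> pq.
  have := has_cintegralD (has_cintegralD (has_cintegralD
    (mom p.+1 q.+2 'i%C ltac:(lia)) (mom p.+2 q.+1 (-1) ltac:(lia)))
    (mom p q.+1 (- ('i%C * u%:C)) ltac:(lia))) (mom p.+1 q u%:C ltac:(lia)).
  by apply: eq_has_cintegral => [z|]; rewrite /hmoment; ring.
by split; apply: (has_cintegral_eq0 P0 (Ph _ _)); apply: hmoment_int.
Qed.

End HMoments.

(** * The seven nodes *)

Section RealCoordinates.
Context (R : realType).
Implicit Types (t u : R) (w g : nat -> nat -> R[i]) (z : R[i]).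

Lemma zmonom01 z : zmonom 0 1 z = z.
Proof. by rewrite /zmonom mul1r. Qed.

Lemma zmonom10 z : zmonom 1 0 z = conjc z.
Proof. by rewrite /zmonom mulr1. Qed.

Lemma polyfun_widen n m (f : R[i] -> R[i]) :
  (n <= m)%N -> polyfun n f -> polyfun m f.
Proof.
move=> nm [c fE].
apply: (@eq_polyfun _ m (fun z => \sum_(k : mono n) c k *
  zmonom (val k).1 (val k).2 z)) => [z|]; first by rewrite fE.
apply: polyfun_sum => k; apply/polyfunZ/polyfun_zmonom.
exact: leq_trans (valP k) nm.
Qed.

Let X z : R := complex.Re z + complex.Im z.
Let Y z : R := complex.Re z - complex.Im z.

Lemma polyfun_XY a b : polyfun (a + b) (fun z => (X z ^+ a * Y z ^+ b)%:C).
Proof.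
have pX : polyfun 1 (fun z => (X z)%:C).
  (* [X] is the real part of [(1 - i) z]; likewise [Y] below is that of [(1 + i) z]. *)
  apply: (@eq_polyfun _ _ (fun z => 2^-1%:C * (1 - 'i%C) * zmonom 0 1 z +
      2^-1%:C * (1 + 'i%C) * zmonom 1 0 z)) => [[x y]|].
    by rewrite /X zmonom10 zmonom01; apply/eqP;
      rewrite eq_complex /=; apply/andP; split; apply/eqP; field.
  by apply: polyfunD; apply/polyfunZ/polyfun_zmonom.
have pY : polyfun 1 (fun z => (Y z)%:C).
  apply: (@eq_polyfun _ _ (fun z => 2^-1%:C * (1 + 'i%C) * zmonom 0 1 z +
      2^-1%:C * (1 - 'i%C) * zmonom 1 0 z)) => [[x y]|].
    by rewrite /Y zmonom10 zmonom01; apply/eqP;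
      rewrite eq_complex /=; apply/andP; split; apply/eqP; field.
  by apply: polyfunD; apply/polyfunZ/polyfun_zmonom.
elim: a => [|a IHa]; last first.
  apply: (@eq_polyfun _ _ (fun z => (X z)%:C * (X z ^+ a * Y z ^+ b)%:C)) => [z|].
    by rewrite -rmorphM exprS mulrA.
  exact: polyfunM pX IHa.
elim: b => [|b IHb].
  apply: (@eq_polyfun _ _ (zmonom 0 0)) => [z|]; first by rewrite /zmonom !mul1r.
  exact: polyfun_zmonom.
apply: (@eq_polyfun _ _ (fun z => (Y z)%:C * (X z ^+ 0 * Y z ^+ b)%:C)) => [z|].
  by rewrite -rmorphM !mul1r exprS.
exact: polyfunM pY IHb.
Qed.

(** The test polynomials are the real combinations of [1], [X], [Y], [X^2], [XY], [Y^2], [X^2 Y], a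
    span that contains the interpolation cubics of the seven nodes. *)
Lemma psdmx_atoms_real w (s : seq (R * R[i])) k00 k10 k01 k20 k11 k02 k21 :
    psdmx (moment_matrix 3 w) ->
    (forall p q, (p + q <= 6)%N ->
       w p q = \sum_(a <- s) a.1%:C * zmonom p q a.2) ->
  0 <= \sum_(a <- s) a.1 * (k00 + k10 * X a.2 + k01 * Y a.2 + k20 * X a.2 ^+ 2
         + k11 * (X a.2 * Y a.2) + k02 * Y a.2 ^+ 2
         + k21 * (X a.2 ^+ 2 * Y a.2)) ^+ 2.
Proof.
move=> M_psd ws; pose L z := k00 + k10 * X z + k01 * Y z + k20 * X z ^+ 2
  + k11 * (X z * Y z) + k02 * Y z ^+ 2 + k21 * (X z ^+ 2 * Y z).
have pXY a b : (a + b <= 3)%N -> polyfun 3 (fun z => (X z ^+ a * Y z ^+ b)%:C).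
  by move=> ab; apply: polyfun_widen ab (polyfun_XY a b).
have [f fE] : polyfun 3 (fun z => (L z)%:C).
  have := polyfunD (polyfunD (polyfunD (polyfunD (polyfunD (polyfunD
    (polyfunZ k00%:C (pXY 0 0 isT)) (polyfunZ k10%:C (pXY 1 0 isT)))
    (polyfunZ k01%:C (pXY 0 1 isT))) (polyfunZ k20%:C (pXY 2 0 isT)))
    (polyfunZ k11%:C (pXY 1 1 isT))) (polyfunZ k02%:C (pXY 0 2 isT)))
    (polyfunZ k21%:C (pXY 2 1 isT)).
  apply: eq_polyfun => z; rewrite /L; ring.
have := psdmx_atoms f M_psd ws; rewrite -ler0c; congr (0 <= _).
rewrite rmorph_sum; apply: eq_bigr => a _.
by rewrite -fE -/(L a.2) rmorphM conjcE rmorphXn.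
Qed.

End RealCoordinates.

(* The witnesses are the values of the moment functional at the Lagrange
   interpolation cubics of the nodes [(0,0), (0,al), (0,-al), (be,de), (be,-de),
   (-be,de), (-be,-de)], in this order. *)
Lemma seven_point_quadrature (F : fieldType) (al be de : F)
    (m00 m10 m01 m20 m11 m02 m21 : F) :
    (2%:R : F) != 0 -> al != 0 -> be != 0 -> de != 0 ->
  exists c0 c1 c2 c3 c4 c5 c6 : F,
    [/\ c0 + c1 + c2 + c3 + c4 + c5 + c6 = m00,
       c3 * be + c4 * be - c5 * be - c6 * be = m10 &
       c1 * al - c2 * al + c3 * de - c4 * de + c5 * de - c6 * de = m01]
    /\ [/\ c3 * be ^+ 2 + c4 * be ^+ 2 + c5 * be ^+ 2 + c6 * be ^+ 2 = m20,
       c3 * be * de - c4 * be * de - c5 * be * de + c6 * be * de = m11,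
       c1 * al ^+ 2 + c2 * al ^+ 2 + c3 * de ^+ 2 + c4 * de ^+ 2 + c5 * de ^+ 2
         + c6 * de ^+ 2 = m02 &
       c3 * be ^+ 2 * de - c4 * be ^+ 2 * de + c5 * be ^+ 2 * de
         - c6 * be ^+ 2 * de = m21].
Proof.
move=> two al0 be0 de0.
(* [c s r] is the weight at [(s be, r de)], from the cubic [X (X + s be) (Y + r de)]; [d s] is the
   weight at [(0, s al)], from [Y (Y + s al) - (de^2 / be^2) X^2 - (s al / be^2) X^2 Y]. *)
pose c (s r : F) := (m21 + s * be * m11 + r * de * m20 + s * r * be * de * m10)
  / (4 * be ^+ 2 * r * de).
pose d (s : F) := (m02 + s * al * m01 - de ^+ 2 / be ^+ 2 * m20
  - s * al / be ^+ 2 * m21) / (2 * al ^+ 2).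
exists (m00 - m02 / al ^+ 2 + (de ^+ 2 - al ^+ 2) / (al ^+ 2 * be ^+ 2) * m20).
exists (d 1), (d (-1)), (c 1 1), (c 1 (-1)), (c (-1) 1), (c (-1) (-1)).
have four : 4%:R != 0 :> F by rewrite (natrM _ 2 2) mulf_neq0.
have m1 : (-1 : F) != 0 by rewrite oppr_eq0 oner_eq0.
by rewrite /c /d; do ?split; field; rewrite ?al0 ?be0 ?de0 ?two ?four ?m1 ?oner_eq0.
Qed.

Lemma seven_point_weights_ge0 (F : realFieldType) (al be de : F)
    (c0 c1 c2 c3 c4 c5 c6 : F) :
    al != 0 -> be != 0 -> de != 0 ->
    (forall k00 k10 k01 k20 k11 k02 k21 : F,
      let L x y := k00 + k10 * x + k01 * y + k20 * x ^+ 2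
        + k11 * (x * y) + k02 * y ^+ 2 + k21 * (x ^+ 2 * y) in
      0 <= c0 * L 0 0 ^+ 2 + c1 * L 0 al ^+ 2 + c2 * L 0 (- al) ^+ 2
         + c3 * L be de ^+ 2 + c4 * L be (- de) ^+ 2
         + c5 * L (- be) de ^+ 2 + c6 * L (- be) (- de) ^+ 2) ->
  [&& 0 <= c0, 0 <= c1, 0 <= c2, 0 <= c3, 0 <= c4, 0 <= c5 & 0 <= c6].
Proof.
move=> al0 be0 de0 c_ge0.
have ge0 (x c e : F) : x != 0 -> e = c * x ^+ 2 -> 0 <= e -> 0 <= c.
  by move=> x0 ->; rewrite pmulr_lge0 // exprn_even_gt0.
have A0 : al ^+ 2 * be ^+ 2 != 0 by rewrite mulf_neq0 // expf_neq0.
have D0 : 2 * al ^+ 2 * be ^+ 2 != 0.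
  by rewrite !mulf_neq0 ?expf_neq0 ?pnatr_eq0.
have C0 : 4 * be ^+ 2 * de != 0 by rewrite !mulf_neq0 ?expf_neq0 ?pnatr_eq0.
(* The cubics [be^2 Y (Y + a) - de^2 X^2 - a X^2 Y] and [X (X + b) (Y + d)], which
   vanish at all nodes but [(0, a)] and [(b, d)], respectively. *)
have D a := c_ge0 0 0 (a * be ^+ 2) (- de ^+ 2) 0 (be ^+ 2) (- a).
have C b d := c_ge0 0 (b * d) 0 d b 0 1.
apply/and5P; split; last (apply/and3P; split).
(* The origin is isolated by [al^2 be^2 + (de^2 - al^2) X^2 - be^2 Y^2]. *)
- have := c_ge0 (al ^+ 2 * be ^+ 2) 0 0 (de ^+ 2 - al ^+ 2) 0 (- be ^+ 2) 0.
  by apply: ge0 A0 _; ring.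
- by apply: ge0 D0 _ (D al); ring.
- by apply: ge0 D0 _ (D (- al)); ring.
- by apply: ge0 C0 _ (C be de); ring.
- by apply: ge0 C0 _ (C be (- de)); ring.
- by apply: ge0 C0 _ (C (- be) de); ring.
- by apply: ge0 C0 _ (C (- be) (- de)); ring.
Qed.

(** * Finitely atomic measures carried by zeros of P *)

Section AtomicMeasures.
Context (R : realType).
Implicit Types (t u : R) (w g : nat -> nat -> R[i]).

Definition cmeasurable (f : borelC R -> R[i]) : Prop :=
  measurable_fun setT (fun z => complex.Re (f z)) /\
  measurable_fun setT (fun z => complex.Im (f z)).

Lemma cmeasurableM f1 f2 :
  cmeasurable f1 -> cmeasurable f2 -> cmeasurable (fun z => f1 z * f2 z).
Proof.
move=> [r1 i1] [r2 i2]; split.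
  rewrite (_ : (fun z => _) = fun z => complex.Re (f1 z) * complex.Re (f2 z)
      - complex.Im (f1 z) * complex.Im (f2 z)).
    by apply: measurable_funB; apply: measurable_funM.
  by apply/funext => z; case: (f1 z) (f2 z) => ? ? [].
rewrite (_ : (fun z => _) = fun z => complex.Re (f1 z) * complex.Im (f2 z)
    + complex.Im (f1 z) * complex.Re (f2 z)).
  by apply: measurable_funD; apply: measurable_funM.
by apply/funext => z; case: (f1 z) (f2 z) => ? ? [].
Qed.

Lemma cmeasurable_zmonom p q : cmeasurable (zmonom p q).
Proof.
have cX (f : borelC R -> R[i]) n : cmeasurable f -> cmeasurable (fun z => f z ^+ n).
  move=> mf; elim: n => [|n IHn]; first by split; apply: measurable_cst.
  by rewrite (_ : (fun z => _) = fun z => f z * f z ^+ n);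
    [exact: cmeasurableM | apply/funext => z; rewrite exprS].
have mz : cmeasurable (fun z => (z : R[i])).
  by split; [exact: measurable_Re | exact: measurable_Im].
apply: cmeasurableM; apply: cX => //; split.
  rewrite (_ : (fun z => _) = @complex.Re R); first exact: measurable_Re.
  by apply/funext => -[].
rewrite (_ : (fun z => _) = (fun z => - complex.Im z)).
  by apply: measurableT_comp => //; exact: measurable_Im.
by apply/funext => -[].
Qed.

Lemma atoms_sumE (s : seq (R * R[i])) (F : R[i] -> R[i]) :
  \sum_(a <- s) a.1%:C * F a.2 =
  (\sum_(a <- s) a.1 * complex.Re (F a.2)) +i*
  (\sum_(a <- s) a.1 * complex.Im (F a.2)).
Proof.
elim: s => [|a s IHs]; first by rewrite !big_nil.
rewrite !big_cons IHs; case: (F a.2) => x y; apply/eqP.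
by rewrite eq_complex /= !mul0r subr0 addr0 !eqxx.
Qed.

Lemma atomic_representing_measure (s : seq (R * R[i])) :
    all (fun a => 0 <= a.1) s ->
  exists mu : {measure set (borelC R) -> \bar R}, representing_measure setT
    (fun p q => \sum_(a <- s) a.1%:C * zmonom p q a.2) mu.
Proof.
move=> /(@atomic_measure R _ (borelC R))[mu muE]; exists mu => p q _.
have [mr mi] := cmeasurable_zmonom p q.
have [ir rE] := muE _ mr; have [ii iE] := muE _ mi.
by split; [split | rewrite atoms_sumE /cintegral rE iE].
Qed.

Section Atoms.
Context t u (s : seq (R * R[i])).
Let G p q : R[i] := \sum_(a <- s) a.1%:C * zmonom p q a.2.
Hypothesis s_cubic : forall a, a \in s ->
  a.2 ^+ 3 = 'i%C * t%:C * a.2 + u%:C * conjc a.2.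

Lemma atoms_herm p q : G q p = conjc (G p q).
Proof.
rewrite /G !atoms_sumE; apply/eqP; rewrite eq_complex /= -sumrN; apply/andP.
by split; apply/eqP/eq_bigr => a _; rewrite zmonom_conj;
  case: (zmonom p q _) => x y //=; rewrite mulrN.
Qed.

Lemma atoms_rec p q : G p q.+3 = 'i%C * t%:C * G p q.+1 + u%:C * G p.+1 q.
Proof.
rewrite /G !mulr_sumr -big_split; apply: eq_big_seq => a /s_cubic a3.
by rewrite (zmonom_rec a3) /=; ring.
Qed.

Lemma atoms_hmoment p q : t - u < 0 -> hmoment u G p q = 0.
Proof.
move=> tu; transitivity (\sum_(a <- s) a.1%:C * hmoment u (fun p q => zmonom p q a.2) p q).
  rewrite /hmoment /G !mulr_sumr -!sumrN -!big_split; apply: eq_bigr => a _ /=.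
  by ring.
by apply: big1_seq => a /andP[_ /s_cubic a3]; rewrite (hmoment_zmonom _ _ tu) ?mulr0.
Qed.

End Atoms.

(* The point where [X = x] and [Y = y]. *)
Definition node (x y : R) : R[i] := ((x + y) / 2) +i* ((x - y) / 2).

(** The hypotheses are relations shared by all seven nodes: the factor [x] covers the nodes with
    [x = 0], and the third one holds at the others because [- 2 (t + u) + 3 be^2 = de^2]. *)
Lemma node_cubic t u (x y : R) :
    x ^+ 3 = (u + t / 2) * x -> x * y ^+ 2 = (u - t / 2) * x ->
    y ^+ 3 = - 2 * (t + u) * y + 3 * x ^+ 2 * y ->
  node x y ^+ 3 = 'i%C * t%:C * node x y + u%:C * conjc (node x y).
Proof.
move=> x3 xy2 y3; rewrite /node !exprS expr0; apply/eqP; rewrite eq_complex /=.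
by apply/andP; split; apply/eqP; lra.
Qed.

Lemma zmonom_node (x y : R) :
  (zmonom 0 2 (node x y) = (x * y) +i* ((x ^+ 2 - y ^+ 2) / 2)) *
  (zmonom 1 1 (node x y) = ((x ^+ 2 + y ^+ 2) / 2) +i* 0) *
  (zmonom 1 2 (node x y) =
     ((x ^+ 3 + x ^+ 2 * y + x * y ^+ 2 + y ^+ 3) / 4) +i*
     ((x ^+ 3 - x ^+ 2 * y + x * y ^+ 2 - y ^+ 3) / 4)).
Proof.
rewrite (zmonomD 0 1 0 1) (zmonomD 1 1 0 1) (zmonomD 1 0 0 1).
rewrite zmonom10 zmonom01 /node.
by do ?split; apply/eqP; rewrite eq_complex /=; apply/andP; split; apply/eqP; field.
Qed.

Lemma exists_representing_measure t u w g :
    u < - t -> - t < 2 * u ->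
    psdmx (moment_matrix 3 w) -> (forall p q, (p + q <= 6)%N -> w p q = g p q) ->
    (forall p q, g q p = conjc (g p q)) ->
    (forall p q, g p q.+3 = 'i%C * t%:C * g p q.+1 + u%:C * g p.+1 q) ->
    hmoment u g 0 0 = 0 -> hmoment u g 0 1 = 0 ->
  exists mu : {measure set (borelC R) -> \bar R},
    representing_measure setT g mu.
Proof.
move=> ut tu M_psd wg g_herm g_rec h00 h01.
(* The inequalities [u < - t < 2 u] make all three radicands positive. *)
pose al := Num.sqrt (- 2 * (t + u)); pose be := Num.sqrt (u + t / 2).
pose de := Num.sqrt (u - t / 2).
have al2 : al ^+ 2 = - 2 * (t + u) by rewrite sqr_sqrtr //; lra.
have be2 : be ^+ 2 = u + t / 2 by rewrite sqr_sqrtr //; lra.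
have de2 : de ^+ 2 = u - t / 2 by rewrite sqr_sqrtr //; lra.
have al0 : al != 0 by rewrite sqrtr_eq0 -ltNge; lra.
have be0 : be != 0 by rewrite sqrtr_eq0 -ltNge; lra.
have de0 : de != 0 by rewrite sqrtr_eq0 -ltNge; lra.
clearbody al be de.
have g00 : complex.Im (g 0%N 0%N) = 0.
  by have := congr1 (@complex.Im R) (g_herm 0%N 0%N); case: (g _ _) => x y /=; lra.
have g11 : complex.Im (g 1%N 1%N) = 0.
  by have := congr1 (@complex.Im R) (g_herm 1%N 1%N); case: (g _ _) => x y /=; lra.
(* The last value is that of the functional at [X^2 Y], in which the recursion
   eliminates [z^3]. *)
have [c0 [c1 [c2 [c3 [c4 [c5 [c6 [[e00 e10 e01] [e20 e11 e02 e21]]]]]]]]] :=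
  @seven_point_quadrature R al be de
    (complex.Re (g 0%N 0%N))
    (complex.Re (g 0%N 1%N) + complex.Im (g 0%N 1%N))
    (complex.Re (g 0%N 1%N) - complex.Im (g 0%N 1%N))
    (* [X^2], [XY], [Y^2] are [|z|^2 + Im z^2], [Re z^2], [|z|^2 - Im z^2]. *)
    (complex.Re (g 1%N 1%N) + complex.Im (g 0%N 2%N))
    (complex.Re (g 0%N 2%N))
    (complex.Re (g 1%N 1%N) - complex.Im (g 0%N 2%N))
    ((complex.Re (g 1%N 2%N) - complex.Im (g 1%N 2%N)) / 2 +
      (t + u) * (complex.Re (g 0%N 1%N) - complex.Im (g 0%N 1%N)) / 2)
    ltac:(by rewrite pnatr_eq0) al0 be0 de0.
pose s := [:: (c0, node 0 0); (c1, node 0 al); (c2, node 0 (- al));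
  (c3, node be de); (c4, node be (- de)); (c5, node (- be) de);
  (c6, node (- be) (- de))].
(* [G] comes from weights of unknown sign. It is first shown equal to [g]; only then does [M_psd]
   give the signs. *)
pose G p q : R[i] := \sum_(a <- s) a.1%:C * zmonom p q a.2.
have al3 : al ^+ 3 = - 2 * (t + u) * al by rewrite exprSr al2.
have be3 : be ^+ 3 = (u + t / 2) * be by rewrite exprSr be2.
have de3 : de ^+ 3 = (u - t / 2) * de by rewrite exprSr de2.
have bd2 : be * de ^+ 2 = (u - t / 2) * be by rewrite de2 mulrC.
have b2d : be ^+ 2 * de = (u + t / 2) * de by rewrite be2.
have s_cubic a : a \in s -> a.2 ^+ 3 = 'i%C * t%:C * a.2 + u%:C * conjc a.2.
  by rewrite !inE => /or4P[|||/or4P[|||]] /eqP-> /=; apply: node_cubic; lra.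
have G_herm p q : G q p = conjc (G p q) := atoms_herm s p q.
have G_rec p q : G p q.+3 = 'i%C * t%:C * G p q.+1 + u%:C * G p.+1 q :=
  atoms_rec s_cubic p q.
have tu0 : t - u < 0 by lra.
have G_hmoment p q : hmoment u G p q = 0 := atoms_hmoment s_cubic p q tu0.
have GE p q : G p q = (\sum_(a <- s) a.1 * complex.Re (zmonom p q a.2)) +i*
  (\sum_(a <- s) a.1 * complex.Im (zmonom p q a.2)) by exact: atoms_sumE.
have G01 : G 0%N 1%N = g 0%N 1%N.
  rewrite GE /s !big_cons !big_nil !zmonom01 /=; apply/eqP; rewrite eq_complex /=.
  by apply/andP; split; apply/eqP; lra.
have G02 : G 0%N 2%N = g 0%N 2%N.
  rewrite GE /s !big_cons !big_nil !zmonom_node /=; apply/eqP; rewrite eq_complex /=.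
  by apply/andP; split; apply/eqP; lra.
have G11 : G 1%N 1%N = g 1%N 1%N.
  rewrite GE /s !big_cons !big_nil !zmonom_node /=; apply/eqP; rewrite eq_complex /=.
  by apply/andP; split; apply/eqP; lra.
have G00 : G 0%N 0%N = g 0%N 0%N.
  rewrite GE /s !big_cons !big_nil /zmonom /=; apply/eqP; rewrite eq_complex /=.
  by apply/andP; split; apply/eqP; lra.
(* The seven prescribed values leave open [Re + Im] of entry (1,2) and the entry (2,2). The
   vanishing moments of [h] and [zh] determine both, for [g] as for [G]. *)
have g12 := (hmoment00E u (g_herm 1%N 2%N) (g_herm 0%N 1%N)).1 h00.
have g22 := (hmoment01E (g_herm 0%N 2%N) (g_rec 1%N 0%N)).1 h01.
have G22 := (hmoment01E (G_herm 0%N 2%N) (G_rec 1%N 0%N)).1 (G_hmoment 0%N 1%N).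
have G12 : G 1%N 2%N = g 1%N 2%N.
  (* Entry (1,2) involves [X^3], [X Y^2] and [Y^3]; on the nodes these reduce to [X], [Y] and
     [X^2 Y]. *)
  have e30 : c3 * be ^+ 3 + c4 * be ^+ 3 - c5 * be ^+ 3 - c6 * be ^+ 3 =
      (u + t / 2) * (complex.Re (g 0%N 1%N) + complex.Im (g 0%N 1%N)).
    by rewrite -e10 be3; ring.
  have e12 : c3 * (be * de ^+ 2) + c4 * (be * de ^+ 2) - c5 * (be * de ^+ 2)
      - c6 * (be * de ^+ 2) =
      (u - t / 2) * (complex.Re (g 0%N 1%N) + complex.Im (g 0%N 1%N)).
    by rewrite -e10 bd2; ring.
  have e03 : c1 * al ^+ 3 - c2 * al ^+ 3 + c3 * de ^+ 3 - c4 * de ^+ 3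
      + c5 * de ^+ 3 - c6 * de ^+ 3 =
      - 2 * (t + u) * (complex.Re (g 0%N 1%N) - complex.Im (g 0%N 1%N)) +
      3 * (c3 * be ^+ 2 * de - c4 * be ^+ 2 * de + c5 * be ^+ 2 * de
         - c6 * be ^+ 2 * de).
    by rewrite -e01 be2 al3 de3; field.
  rewrite GE /s !big_cons !big_nil !zmonom_node /=; apply/eqP; rewrite eq_complex /=.
  by apply/andP; split; apply/eqP; lra.
have Gg p q : G p q = g p q.
  apply: (@eq_trunc_cubic_seq R t u (p + q)) => // k l.
  case: l => [|[|[|l]]]; last by rewrite andbF.
  - by case: k.
  - by case: k => [|[|k]].
  - by case: k => [|[|[|k]]] // _ _; rewrite G22 g22 G11 G02.
have nodeX x y : complex.Re (node x y) + complex.Im (node x y) = x.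
  by rewrite /node /=; field.
have nodeY x y : complex.Re (node x y) - complex.Im (node x y) = y.
  by rewrite /node /=; field.
have c_ge0 : all (fun a => 0 <= a.1) s.
  rewrite /s /= andbT; apply: (seven_point_weights_ge0 al0 be0 de0).
  move=> k00 k10 k01 k20 k11 k02 k21.
  have := psdmx_atoms_real k00 k10 k01 k20 k11 k02 k21 M_psd
    (fun p q pq => etrans (wg p q pq) (esym (Gg p q))).
  by rewrite /s !big_cons big_nil /= !nodeX !nodeY addr0 !addrA.
have [mu mu_G] := atomic_representing_measure c_ge0.
by exists mu => p q _; rewrite -Gg; exact: mu_G.
Qed.

End AtomicMeasures.

(** * Equivalence of the six conditions *)

Theorem theorem20 (R : realType) (w : nat -> nat -> R[i]) (t u : R)
    (g : nat -> nat -> R[i])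
    (M := moment_matrix 3 w)
    (h := 'i%C%:P%:P * ('X + 'i%C%:P%:P * 'Y) * ('X * 'Y - u%:C%:P%:P)
          : {poly {poly R[i]}})
    (w_herm : forall i j, (i + j <= 6)%N -> (w i j)^* = w j i)
    (w00_gt0 : 0 < w 0%N 0%N)
    (M_psd : psdmx M)
    (M_rel : mcol M 0 3 = ('i%C * t%:C) *: mcol M 0 1 + u%:C *: mcol M 1 0)
    (u_lt_t : u < - t) (t_lt_2u : - t < 2 * u)
    (g_rdis : is_rdis 3
       ('X^3 - ('i%C * t%:C)%:P%:P * 'X - u%:C%:P%:P * 'Y) w g) :
  [<->
    (* (i) *)
    exists mu : {measure set (borelC R) -> \bar R},
      representing_measure [set pq | (pq.1 + pq.2 <= 6)%N] w mu;
    (* (ii) *)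
    exists mu : {measure set (borelC R) -> \bar R},
      representing_measure setT g mu;
    (* (iii) *)
    Lambda w h = 0 /\ Lambda w ('X * h) = 0;
    (* (iv) *)
    complex.Re (w 1%N 2%N) + complex.Im (w 1%N 2%N) =
      u * (complex.Re (w 0%N 1%N) + complex.Im (w 0%N 1%N)) /\
    w 2%N 2%N = (u - t)%:C * w 1%N 1%N + (2 * u * complex.Im (w 0%N 2%N))%:C;
    (* (v) *)
    char_polys g h;
    (* (vi) *)
    mcol M 1 2 + 'i%C *: mcol M 2 1 - u%:C *: mcol M 0 1
      - ('i%C * u%:C) *: mcol M 1 0 = 0 ].
Proof.
have [g_init g_herm g_rec] := is_rdis_cubic g_rdis.
have tu0 : t - u < 0 by lra.
have w_conj i j : (i + j <= 6)%N -> w j i = conjc (w i j).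
  by move=> ij; rewrite -w_herm.
have w_rec p q : (p + q.+3 <= 6)%N ->
    w p q.+3 = 'i%C * t%:C * w p q.+1 + u%:C * w p.+1 q.
  have linE n (a b : 'cV[R[i]]_n) x y k :
      (x *: a + y *: b) k ord0 = x * a k ord0 + y * b k ord0 by rewrite !mxE.
  (* The exponents are swapped: in the row of [zbar^q z^p] the column of [z^3] has the entry
     [w p (q + 3)]. *)
  move=> pq; have /colP/(_ (enum_rank (mon 3 q p))) := M_rel.
  by rewrite linE !mcol_mon; try lia.
have wg p q : (p + q <= 6)%N -> w p q = g p q.
  move=> pq; apply/esym.
  apply: (eq_trunc_cubic_seq w_conj w_rec g_herm g_rec) => // k l kl _.
  exact: g_init.
have hmoment_wg p q : (p + q <= 3)%N -> hmoment u w p q = hmoment u g p q.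
  by move=> pq; rewrite /hmoment !wg //; lia.
have hmoment_mu : hmoment u g 0 0 = 0 -> hmoment u g 0 1 = 0 ->
    exists mu : {measure set (borelC R) -> \bar R}, representing_measure setT g mu.
  exact: (exists_representing_measure u_lt_t t_lt_2u M_psd wg g_herm g_rec).
pose C := mcol M 1 2 + 'i%C *: mcol M 2 1 - u%:C *: mcol M 0 1
  - ('i%C * u%:C) *: mcol M 1 0.
(* The polynomial in (vi) is [- i h], and a row pairs it with the conjugate of the row monomial,
   hence the swapped indices. *)
have CE (m : mono 3) :
    C (enum_rank m) ord0 = - 'i%C * hmoment u w (val m).2 (val m).1.
  have linE n (a b c d : 'cV[R[i]]_n) x y k :
      (a + x *: b - y *: c - (x * y) *: d) k ord0 =
      a k ord0 + x * b k ord0 - y * c k ord0 - x * y * d k ord0.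
    by rewrite !mxE.
  rewrite /C linE !mcolE // /hmoment !add0n !add1n !add2n; ring: (mulii R).
have C0_hmoment : C = 0 -> hmoment u g 0 0 = 0 /\ hmoment u g 0 1 = 0.
  move=> C0; have hmoment_mon p q : (p + q <= 3)%N -> hmoment u g p q = 0.
    move=> pq; have := CE (mon 3 q p).
    rewrite C0 mxE val_mon /= ?inordK; try lia.
    rewrite hmoment_wg // => /esym/eqP.
    by rewrite mulf_eq0 oppr_eq0 eq_complex /= oner_eq0 andbF => /eqP.
  by split; apply: hmoment_mon.
(* The implications form a cycle in the stated order. The steps from (i) to (ii) and from (vi) to
   (i) both derive the vanishing moments of [h] and [zh] and then construct a measure for [g]. *)
tfae.
- move=> [mu mu_w]; apply: hmoment_mu; rewrite -hmoment_wg //.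
  + by have [] := representing_measure_hmoment tu0 (fun=> id) w_rec mu_w.
  + by have [] := representing_measure_hmoment tu0 (fun=> id) w_rec mu_w.
- move=> [mu mu_g]; rewrite Lambda_h Lambda_zh !hmoment_wg //.
  by apply: (representing_measure_hmoment tu0 _ _ mu_g) => // p q _; exact: g_rec.
- rewrite Lambda_h Lambda_zh => -[h00 h01]; split.
    by apply/(hmoment00E u) => //; exact: w_conj.
  by apply/(hmoment01E (t := t)) => //; [exact: w_conj | exact: w_rec].
- move=> [w12 w22] p q; rewrite Lambda_h.
  have h00 : hmoment u g 0 0 = 0.
    by rewrite -hmoment_wg //; apply/(hmoment00E u) => //; exact: w_conj.
  have h01 : hmoment u g 0 1 = 0.
    rewrite -hmoment_wg //; apply/(hmoment01E (t := t)) => //.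
      exact: w_conj.
    exact: w_rec.
  have := hmoment_eq0 g_herm g_rec h00 h01 p q.
  by rewrite /hmoment !addn0 !addnS !addn0.
- move=> gh; have h0 p q : hmoment u g p q = 0.
    by have := gh p q; rewrite Lambda_h /hmoment !addnS !addn0.
  apply/colP => r; rewrite -[r]enum_valK CE hmoment_wg; last first.
    by rewrite addnC; exact: valP (enum_val r).
  by rewrite h0 mulr0 mxE.
- move=> /C0_hmoment[h00 h01]; have [mu mu_g] := hmoment_mu h00 h01.
  exists mu => p q pq.
  by rewrite wg //; exact: mu_g.
Qed.
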